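(* Let $E\subset\mathbb{C}^N$ be a nonpluripolar compact set, $w$ an admissible weight function on $E$, and $\mu$ a finite positive Borel measure with support in $E$ such that $(E,w,\mu)$ satisfies a Bernstein–Markov inequality for weighted polynomials. For $d\ge 1$ let $\mathcal{P}_d$ be the probability measure on $E^{m_d}$ given, for Borel sets $A\subset E^{m_d}$, by $$\mathcal{P}_d(A):=\frac{1}{Z_d}\int_A|VDM(z_1,\dots,z_{m_d})|^2\,w(z_1)^{2d}\cdots w(z_{m_d})^{2d}\,d\mu(z_1)\cdots d\mu(z_{m_d}),$$ where $Z_d$ is the integral of the same integrand over all of $E^{m_d}$. Given $\eta>0$, define $$A_{d,\eta}:=\{(z_1,\dots,z_{m_d})\in E^{m_d}: |VDM(z_1,\dots,z_{m_d})|^2\,w(z_1)^{2d}\cdots w(z_{m_d})^{2d}\ge(\delta^w(E)-\eta)^{2l_d}\}.$$ Then there exists $d^*=d^*(\eta)$ such that for all $d>d^*$, $$\mathcal{P}_d(E^{m_d}\setminus A_{d,\eta})\le\Bigl(1-\frac{\eta}{2\delta^w(E)}\Bigr)^{2l_d}.$$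
   Context: Let $e_1(z),e_2(z),\dots$ be a listing of the monomials $e_i(z)=z^{\alpha(i)}$ in $\mathbb{C}^N$, using a lexicographic ordering on the multiindices $\alpha(i)\in\{0,1,2,\dots\}^N$ but with $\deg e_i=|\alpha(i)|$ nondecreasing. $m_d=\binom{N+d}{d}$ is the number of monomials of degree at most $d$ in $N$ variables and $l_d=N\binom{N+d}{N+1}$ is the sum of their degrees. $VDM(\zeta_1,\dots,\zeta_n)=\det[e_i(\zeta_j)]_{i,j=1,\dots,n}$. An admissible weight function on $E$ is a nonnegative upper semicontinuous function $w$ on $E$ with $\{z\in E:w(z)>0\}$ nonpluripolar. The weighted transfinite diameter is $$\delta^w(E):=\lim_{d\to\infty}\Bigl[\max_{\lambda^{(1)},\dots,\lambda^{(m_d)}\in E}|VDM(\lambda^{(1)},\dots,\lambda^{(m_d)})|\,w(\lambda^{(1)})^d\cdots w(\lambda^{(m_d)})^d\Bigr]^{1/l_d}$$ (the limit exists). $(E,w,\mu)$ satisfies a Bernstein–Markov inequality for weighted polynomials if for every $\epsilon>0$ there is a constant $M=M(\epsilon)$ such that for all $n$ and all holomorphic polynomials $p_n$ of degree at most $n$, $\|w^np_n\|_E\le M(1+\epsilon)^n\|w^np_n\|_{L^2(\mu)}$, where $\|\cdot\|_E$ is the sup norm on $E$.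
   Formalization: The formal theorem takes 0 < η ≤ δ^w(E) instead of every η > 0; the claim fails for instance at η = 2δ^w(E) (closed unit disc, w = 1, arc length), where the right-hand side is 0 but the complement of A_{d,η} has positive probability. *)

(* Defs.v *)
From HB Require Import structures.
From mathcomp Require Import all_boot all_order all_algebra.
(* mpoly comes first and without its notations, which clash with those of
   MathComp-Analysis; its names isMeasure and Measure are then shadowed. *)
From mathcomp.multinomials Require Import -(notations) mpoly.
From mathcomp Require Import all_classical all_reals all_analysis.
From mathcomp Require Import complex.

Set Implicit Arguments.
Unset Strict Implicit.
Unset Printing Implicit Defensive.
Import Order.TTheory GRing.Theory Num.Theory.
Import numFieldNormedType.Exports.
Local Open Scope classical_set_scope.
Local Open Scope ring_scope.

(* The usual topology of C, so that 'rV[R[i]]_N carries that of C^N. *)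
HB.instance Definition _ (R : realType) := NormedModule.copy R[i] (R[i]^o).

(* C^N with its Borel sigma-algebra; the carrier is convertible to
   'rV[R[i]]_N. *)
Definition borelC (R : realType) (N : nat) :=
  g_sigma_algebraType (@open ('rV[R[i]]_N)).
HB.instance Definition _ (R : realType) (N : nat) :=
  Measurable.on (borelC R N).

(* The modulus of a complex number as an element of R (the norm `|z| of R[i]
   takes its values in R[i]). *)
Notation cmod := ComplexField.Normc.normc.

Section ProductMeasure.
Context d (T : measurableType d) (R : realType).
Variable mu : {finite_measure set T -> \bar R}.

Definition tcons n (z : T * n.-tuple T) : n.+1.-tuple T :=
  [tuple of z.1 :: z.2].

Lemma measurable_tcons n : measurable_fun [set: T * n.-tuple T] (@tcons n).
Proof. exact: measurable_cons. Qed.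

Section Step.
Variables (n : nat) (nu : {finite_measure set (n.-tuple T) -> \bar R}).

(* The product of mu and nu, carried over from T * n.-tuple T to n.+1.-tuple T. *)
Definition mcons : set (n.+1.-tuple T) -> \bar R :=
  pushforward (product_measure1 mu nu) (@tcons n).

Let mcons0 : mcons set0 = 0%E.
Proof. by rewrite /mcons /pushforward preimage_set0 measure0. Qed.

Let mcons_ge0 A : (0 <= mcons A)%E.
Proof. by rewrite /mcons /pushforward measure_ge0. Qed.

Let mcons_sigma_additive : semi_sigma_additive mcons.
Proof.
have mt := @measurable_tcons n.
move=> F mF tF mUF; rewrite /mcons /pushforward preimage_bigcup.
apply: measure_semi_sigma_additive.
- by move=> k; rewrite -[X in measurable X]setTI; exact: mt.
- apply/trivIsetP => /= i j _ _ ij; rewrite -preimage_setI.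
  by move/trivIsetP : tF => /(_ _ _ _ _ ij) ->//; rewrite preimage_set0.
- by rewrite -preimage_bigcup -[X in measurable X]setTI; exact: mt.
Qed.

HB.instance Definition _ := isMeasure.Build _ _ _ mcons
  mcons0 mcons_ge0 mcons_sigma_additive.

Let mcons_fin : fin_num_fun mcons.
Proof.
have mconsT : (mcons setT < +oo)%E; last exact: lty_fin_num_fun.
have -> : mcons setT = product_measure1 mu nu (setT `*` setT).
  by rewrite setXTT.
rewrite product_measure1E//.
by rewrite lte_mul_pinfty// ?fin_num_measure// -ge0_fin_numE// fin_num_measure.
Qed.

HB.instance Definition _ := Measure_isFinite.Build _ _ _ mcons mcons_fin.

End Step.

Fixpoint mpow n : {finite_measure set (n.-tuple T) -> \bar R} :=
  if n is k.+1 then mcons (mpow k) else \d_ [tuple].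

End ProductMeasure.

Section Pluripolar.
Variables (R : realType) (N : nat).

Definition upper_semicontinuous (X : topologicalType) (f : X -> \bar R) :=
  lower_semicontinuous (fun x => - f x)%E.

Definition circle_point (c : R[i]) (r t : R) : R[i] :=
  c + (r%:C * (cos t +i* sin t))%C.

(* On the whole of C the sub-mean value property over every circle is
   equivalent to its local form. The constant -oo is allowed. *)
Definition subharmonic (v : R[i] -> \bar R) :=
  [/\ upper_semicontinuous v,
      forall z, (v z < +oo)%E &
      forall (c : R[i]) (r : R), 0 < r ->
        (v c <= ((2 * pi)^-1)%R%:E *
           \int[lebesgue_measure]_(t in `[0%R, (2 * pi)%R])
             v (circle_point c r t))%E].

(* Here too the constant -oo is allowed; pluripolar excludes it. *)
Definition plurisubharmonic (u : 'rV[R[i]]_N -> \bar R) :=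
  [/\ upper_semicontinuous u,
      forall z, (u z < +oo)%E &
      forall a b : 'rV[R[i]]_N, subharmonic (fun x => u (a + x *: b))].

Definition pluripolar (S : set 'rV[R[i]]_N) :=
  exists u : 'rV[R[i]]_N -> \bar R,
    [/\ plurisubharmonic u, (exists z, u z <> -oo%E) &
        S `<=` [set z | u z = -oo%E]].

End Pluripolar.

Section Vandermonde.
Variables (R : realType) (N : nat).

(* The multiindices of degree at most d, sorted by degree and then
   lexicographically: mnmc_le compares the sequences
   |alpha|, alpha_1, ..., alpha_N lexicographically. *)
Definition exponents (d : nat) : seq (multinom N) :=
  sort (@mnmc_le N)
    [seq bmnm m | m <- enum {: bmultinom N d.+1}].

(* The i-th multiindex alpha(i + 1): indices start at 0 here. For 0 < N there
   are more than i multiindices of degree at most i, and exponents i is a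
   prefix of exponents d for i <= d. *)
Definition exponent (i : nat) : multinom N :=
  nth mnm0 (exponents i) i.

Definition monomial (i : nat) (z : 'rV[R[i]]_N) : R[i] :=
  \prod_(k < N) z ord0 k ^+ (exponent i k).

Definition VDM (n : nat) (zeta : n.-tuple (borelC R N)) : R[i] :=
  \det (\matrix_(i < n, j < n) monomial i (tnth zeta j)).

Definition nmon (d : nat) : nat := 'C(N + d, d)%N.

Definition degsum (d : nat) : nat := (N * 'C(N + d, N.+1))%N.

Variables (E : set 'rV[R[i]]_N) (w : 'rV[R[i]]_N -> R).

(* Only the values of w on E matter: subspace E restricts the
   semicontinuity to the relative topology of E. *)
Definition admissible_weight :=
  [/\ forall z, E z -> 0 <= w z,
      upper_semicontinuous (fun z : subspace E => (w z)%:E) &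
      ~ pluripolar [set z | E z /\ 0 < w z]].

Definition Epow (n : nat) : set (n.-tuple (borelC R N)) :=
  [set z | forall j, E (tnth z j)].
Arguments Epow : clear implicits.

Definition max_weighted_VDM (d : nat) : R :=
  sup [set cmod (VDM z) * \prod_(j < nmon d) w (tnth z j) ^+ d
      | z in Epow (nmon d)].

Definition transfinite_diameter : R :=
  limn (fun d => max_weighted_VDM d `^ (degsum d)%:R^-1).

Definition weighted_VDM_sqr (d : nat) (z : (nmon d).-tuple (borelC R N)) : R :=
  cmod (VDM z) ^+ 2 * \prod_(j < nmon d) w (tnth z j) ^+ (2 * d)%N.
Arguments weighted_VDM_sqr : clear implicits.

Definition large_VDM (d : nat) (eta : R) : set ((nmon d).-tuple (borelC R N)) :=
  Epow (nmon d) `&`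
  [set z | (transfinite_diameter - eta) ^+ (2 * degsum d)%N
             <= weighted_VDM_sqr d z].

Variable mu : {finite_measure set (borelC R N) -> \bar R}.

Definition msupport : set 'rV[R[i]]_N :=
  [set z | forall U : set 'rV[R[i]]_N, open U -> U z -> (0 < mu U)%E].

Definition poly_deg_le (n : nat) (p : mpoly N R[i]) :=
  forall m, m \in msupp p -> (mdeg m <= n)%N.

Definition weighted_poly (n : nat) (p : mpoly N R[i])
    (z : borelC R N) : R :=
  w z ^+ n * cmod (meval (z ord0) p).

(* The functions are extended by 0 outside E in the L^2 norm. *)
Definition Bernstein_Markov :=
  forall eps : R, 0 < eps -> exists M : R,
  forall (n : nat) (p : mpoly N R[i]), poly_deg_le n p ->
    ((sup [set weighted_poly n p z | z in E])%:E <=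
     (M * (1 + eps) ^+ n)%:E *
       'N[mu]_2%:E [(EFin \o weighted_poly n p) \_ E])%E.

Definition Zd (d : nat) : \bar R :=
  (\int[mpow mu (nmon d)]_(z in Epow (nmon d)) (weighted_VDM_sqr d z)%:E)%E.

Definition Pd (d : nat) (A : set ((nmon d).-tuple (borelC R N))) : \bar R :=
  ((Zd d)^-1 * \int[mpow mu (nmon d)]_(z in A) (weighted_VDM_sqr d z)%:E)%E.

End Vandermonde.

Arguments Epow {R N} E n.
Arguments weighted_VDM_sqr {R N} w d z.
Arguments large_VDM {R N} E w d eta.
Arguments Pd {R N} E w mu d A.

(* Main.v *)
Require Import Defs.
From mathcomp Require Import all_boot all_order all_algebra.
From mathcomp.multinomials Require Import -(notations) mpoly.
From mathcomp Require Import all_classical all_reals all_analysis measurable_realfun.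
From mathcomp Require Import complex zify ring lra.
Import Order.TTheory GRing.Theory Num.Theory.
Import numFieldNormedType.Exports.
Local Open Scope classical_set_scope.
Local Open Scope ring_scope.
Set Implicit Arguments.
Unset Strict Implicit.
Unset Printing Implicit Defensive.

(* By the Bernstein-Markov inequality in one variable at a time (VDM is a
   polynomial of degree at most d in each of its m_d arguments), the maximum of
   the density over E^(m_d) is at most (K (1 + eps)^d)^(2 m_d) Z_d. As d m_d is at
   most 2 l_d, for large d this factor is at most (1 + O(eps))^(2 l_d), while the
   maximum exceeds (delta - eta/4)^(2 l_d). Outside A_(d, eta) the density is below
   (delta - eta)^(2 l_d), so the probability is at most
   ((delta - eta) (1 + O(eps)) / (delta - eta/4))^(2 l_d), and
   (delta - eta) / (delta - eta/4) < 1 - eta / (2 delta). *)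

(** * Varying one coordinate of a tuple *)

Definition tset (T : Type) n (t : n.-tuple T) (j : 'I_n) (x : T) : n.-tuple T :=
  [tuple if i == j then x else tnth t i | i < n].

Lemma tnth_tset T n (t : n.-tuple T) j x i :
  tnth (tset t j x) i = if i == j then x else tnth t i.
Proof. by rewrite tnth_mktuple. Qed.

Lemma tset_id T n (t : n.-tuple T) j : tset t j (tnth t j) = t.
Proof.
by apply: eq_from_tnth => i; rewrite tnth_tset; case: eqVneq => [->|].
Qed.

Lemma tset_tcons0 d (T : measurableType d) n (t : n.-tuple T) (x y : T) :
  tset (tcons (x, t)) ord0 y = tcons (y, t).
Proof.
apply: eq_from_tnth => i; rewrite tnth_tset.
by case: (unliftP ord0 i) => [j ->|->]; rewrite ?tnthS ?eqxx ?tnth0.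
Qed.

Lemma tset_tconsS d (T : measurableType d) n (t : n.-tuple T) (x y : T) j :
  tset (tcons (x, t)) (lift ord0 j) y = tcons (x, tset t j y).
Proof.
apply: eq_from_tnth => i; rewrite tnth_tset.
case: (unliftP ord0 i) => [k ->|->].
  by rewrite (inj_eq lift_inj) !tnthS tnth_tset.
by rewrite !tnth0.
Qed.

(** * Iterated integration against a power of a finite measure *)

Section MeasurePower.
Context d (T : measurableType d) (R : realType).
Variable mu : {finite_measure set T -> \bar R}.
Local Open Scope ereal_scope.

Lemma mpow_setT n : mpow mu n setT = mu setT ^+ n.
Proof.
elim: n => [|n IHn]; first by rewrite /= diracE mem_setT.
rewrite expeS -IHn /= /mcons /pushforward preimage_setT -setXTT.
by rewrite product_measure1E.
Qed.

(** By definition [mpow mu n.+1] is the image under [tcons] of a product measure, so a change of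
    variables reduces this to Tonelli. *)
Lemma integral_mpowS n (G : n.+1.-tuple T -> \bar R) :
  measurable_fun [set: n.+1.-tuple T] G -> (forall z, 0 <= G z) ->
  \int[mpow mu n.+1]_z G z = \int[mu]_x \int[mpow mu n]_t G (tcons (x, t)).
Proof.
move=> mG G0; rewrite [LHS](_ : _ =
  \int[pushforward (mu \x mpow mu n) (@tcons _ T n)]_z G z)//.
have mt := @measurable_tcons _ T n.
rewrite ge0_integral_pushforward//= fubini_tonelli1//.
exact: measurableT_comp.
Qed.

(* Integrate out the coordinates one at a time. *)
Lemma le_integral_mpow n (C : \bar R) (G : n.-tuple T -> \bar R) :
  0 <= C -> measurable_fun [set: n.-tuple T] G -> (forall z, 0 <= G z) ->
  (forall z j, G z <= C * \int[mu]_x G (tset z j x)) ->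
  forall z, G z <= C ^+ n * \int[mpow mu n]_t G t.
Proof.
move=> C0; elim: n G => [|n IHn] G mG G0 HG z.
  rewrite expe0 mul1e /= integral_dirac// diracE mem_setT mul1e.
  by rewrite (tuple0 z).
have mt := @measurable_tcons _ T n.
have mGt : measurable_fun setT (G \o @tcons _ T n) by exact: measurableT_comp.
have mGx x : measurable_fun setT (fun t => G (tcons (x, t))).
  exact: (measurableT_comp mGt (measurable_pair1 _)).
(* The first coordinate is frozen at [y], and the induction hypothesis is applied to the slice. *)
have Gz y : G (tcons (y, behead_tuple z)) <=
    C ^+ n * \int[mpow mu n]_t G (tcons (y, t)).
  apply: (IHn (fun t => G (tcons (y, t)))) => // t j.
  apply: le_trans (HG _ (lift ord0 j)) _.
  by under eq_integral do rewrite tset_tconsS.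
have mF : measurable_fun setT
    (fun x => \int[mpow mu n]_t G (tcons (x, t))).
  exact: (measurable_fun_fubini_tonelli_F (m2 := mpow mu n) _ mGt (fun=> G0 _)).
rewrite integral_mpowS// expeS -muleA -ge0_integralZl//; last 2 first.
- by move=> x _; exact: integral_ge0.
- exact: expe_ge0.
have -> : z = tcons (thead z, behead_tuple z).
  by rewrite [LHS]tuple_eta; apply: val_inj.
apply: le_trans (HG _ ord0) _; apply: lee_wpmul2l => //.
under [leLHS]eq_integral do rewrite tset_tcons0.
apply: ge0_le_integral => //.
- exact: (measurableT_comp mGt (measurable_pair2 _)).
- exact: emeasurable_funM.
Qed.

End MeasurePower.

(** * Degrees of the listed monomials *)

Section ExponentDegree.
Variable N : nat.

Lemma mem_exponents d m : (m \in exponents N d) = (mdeg m <= d)%N.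
Proof.
rewrite mem_sort; apply/mapP/idP => [[b _ ->]|md]; first by rewrite -ltnS bmdeg.
by exists (BMultinom (md : (mdeg m < d.+1)%N)); rewrite ?mem_enum.
Qed.

Lemma exponents_sorted d : sorted (fun m1 m2 => mdeg m1 <= mdeg m2)%N (exponents N d).
Proof.
apply: (@sub_sorted _ (@mnmc_le N)); last exact/sort_sorted/lemc_total.
by move=> m1 m2; rewrite /mnmc_le lexi_cons => /andP[].
Qed.

(** The binomial counts the [N]-tuples of naturals with sum at most [d]; these inject into the
    entries of [exponents N i] of degree at most [d]. *)
Lemma count_exponents i d : (d <= i)%N ->
  ('C(N + d, d) <= count (fun m => mdeg m <= d)%N (exponents N i))%N.
Proof.
move=> di; rewrite -[X in 'C(_, X)](addKn N) bin_sub ?leq_addr//.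
rewrite -card_partial_ord_partitions cardE -size_filter.
pose mk (t : N.-tuple 'I_d.+1) : multinom N := Multinom [tuple of map val t].
have mk_inj : injective mk.
  by move=> s t [/(inj_map val_inj) st]; exact: val_inj.
rewrite -(size_map mk); apply: uniq_leq_size.
  by rewrite map_inj_uniq ?enum_uniq.
move=> _ /mapP[t + ->]; rewrite mem_enum inE mem_filter mem_exponents => td.
have mkd : (mdeg (mk t) <= d)%N by rewrite /mdeg big_map.
by rewrite mkd (leq_trans mkd).
Qed.

(** Makes each entry of the Vandermonde matrix of size [nmon N d] a monomial of degree at most [d].
    As the list is sorted by degree, an entry of degree above [d] comes after all those of degree at
    most [d], of which there are at least [nmon N d]. *)
Lemma mdeg_exponent i d : (i < nmon N d)%N -> (mdeg (exponent N i) <= d)%N.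
Proof.
move=> iN; have [id|di] := leqP i d.
  apply: leq_trans id; rewrite /exponent.
  have [si|si] := ltnP i (size (exponents N i)).
    by rewrite -mem_exponents mem_nth.
  (* Beyond the end of the list the default [mnm0] has degree 0. *)
  by rewrite nth_default// mdeg0.
rewrite leqNgt; apply/negP => dm; move: iN; rewrite ltnNge => /negP; apply.
apply: leq_trans (count_exponents (ltnW di)) _.
rewrite -(cat_take_drop i (exponents N i)) count_cat.
(* By sortedness all entries from position [i] on have degree above [d], so the first [i] entries
   carry the whole count, which is then at most [i]. *)
rewrite [X in (_ + X)%N](_ : _ = 0%N) ?addn0; last first.
  apply/eqP; rewrite -leqn0 leqNgt -has_count; apply/hasPn => m.
  move=> /(nthP mnm0)[k]; rewrite size_drop nth_drop ltn_subRL => ks <-.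
  rewrite -ltnNge; apply: leq_trans dm _.
  apply: (sorted_leq_nth (leT := fun m1 m2 => mdeg m1 <= mdeg m2)%N) => //.
  - by move=> ? ? ?; exact: leq_trans.
  - exact: exponents_sorted.
  - by rewrite inE (leq_ltn_trans _ ks)// leq_addr.
  - exact: leq_addr.
apply: leq_trans (count_size _ _) _.
by rewrite size_take_min geq_minl.
Qed.

End ExponentDegree.

(** * The Vandermonde determinant as a polynomial in one argument *)

Section VandermondePolynomial.
Context (R : realType) (N : nat).

(** Laplace expansion along column [j], the only column containing [x]: the cofactors are constants
    and serve as the coefficients of [p]. *)
Lemma VDM_tset d (z : (nmon N d).-tuple (borelC R N)) j :
  exists2 p : mpoly N R[i], poly_deg_le d p &
    forall x : borelC R N,
      VDM (tset z j x) = meval ((x : 'rV[R[i]]_N) ord0) p.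
Proof.
pose M (x : borelC R N) :=
  \matrix_(i < nmon N d, k < nmon N d) monomial i (tnth (tset z j x) k).
pose x0 := tnth z j.
pose p : mpoly N R[i] :=
  \sum_(i < nmon N d) cofactor (M x0) i j *: mpolyX _ (exponent N i).
exists p => [m /msupp_sum_le /flattenP/= [s /mapP[i _ ->]]|x].
  by move=> /msuppZ_le; rewrite msuppX inE => /eqP ->; exact: mdeg_exponent.
rewrite /VDM (expand_det_col _ j) raddf_sum /=; apply: eq_bigr => i _.
rewrite mevalZ mevalX mxE tnth_tset eqxx mulrC; congr (_ * _).
(* The minors omit column [j], so they agree for [x] and for the original point [x0]. *)
rewrite /cofactor; congr (_ * \det _); apply/matrixP => k l.
by rewrite !mxE !tnth_tset eq_sym (negbTE (neq_lift _ _)).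
Qed.

End VandermondePolynomial.

(** * Measurability of complex-valued functions *)

Section ComplexMeasurability.
Context d (T : measurableType d) (R : realType).
Implicit Types f g : T -> R[i].

(** Stated through real and imaginary parts, so that products and sums reduce to real-valued
    measurability. *)
Definition cmeasurable f :=
  measurable_fun [set: T] (fun x => complex.Re (f x)) /\
  measurable_fun [set: T] (fun x => complex.Im (f x)).

Lemma cmeasurable_cst c : cmeasurable (fun=> c).
Proof. by split. Qed.

Lemma cmeasurableD f g : cmeasurable f -> cmeasurable g ->
  cmeasurable (fun x => f x + g x).
Proof.
move=> [fr fi] [gr gi]; split.
- under eq_fun do rewrite raddfD/=; exact: measurable_funD.
- under eq_fun do rewrite raddfD/=; exact: measurable_funD.
Qed.

Lemma cmeasurableM f g : cmeasurable f -> cmeasurable g ->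
  cmeasurable (fun x => f x * g x).
Proof.
move=> [fr fi] [gr gi]; split.
- have -> : (fun x => complex.Re (f x * g x)) = (fun x =>
    complex.Re (f x) * complex.Re (g x) - complex.Im (f x) * complex.Im (g x)).
    by apply/funext => x; case: (f x) => a b; case: (g x).
  by apply: measurable_funB; exact: measurable_funM.
- have -> : (fun x => complex.Im (f x * g x)) = (fun x =>
    complex.Re (f x) * complex.Im (g x) + complex.Im (f x) * complex.Re (g x)).
    by apply/funext => x; case: (f x) => a b; case: (g x).
  by apply: measurable_funD; exact: measurable_funM.
Qed.

Lemma cmeasurable_sum I (s : seq I) (h : I -> T -> R[i]) :
  (forall i, cmeasurable (h i)) -> cmeasurable (fun x => \sum_(i <- s) h i x).
Proof.
move=> mh; elim: s => [|i s IHs].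
  by under eq_fun do rewrite big_nil; exact: cmeasurable_cst.
by under eq_fun do rewrite big_cons; exact: cmeasurableD.
Qed.

Lemma cmeasurable_prod I (s : seq I) (h : I -> T -> R[i]) :
  (forall i, cmeasurable (h i)) -> cmeasurable (fun x => \prod_(i <- s) h i x).
Proof.
move=> mh; elim: s => [|i s IHs].
  by under eq_fun do rewrite big_nil; exact: cmeasurable_cst.
by under eq_fun do rewrite big_cons; exact: cmeasurableM.
Qed.

Lemma cmeasurableX f n : cmeasurable f -> cmeasurable (fun x => f x ^+ n).
Proof.
move=> mf; under eq_fun do rewrite -[n in _ ^+ n]card_ord -prodr_const.
exact: cmeasurable_prod.
Qed.

Lemma measurable_cmod f : cmeasurable f ->
  measurable_fun [set: T] (fun x => cmod (f x)).
Proof.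
move=> [fr fi].
have -> : (fun x => cmod (f x)) = (fun x =>
    Num.sqrt (complex.Re (f x) ^+ 2 + complex.Im (f x) ^+ 2)).
  by apply/funext => x; case: (f x).
apply: (measurableT_comp (continuous_measurable_fun (@sqrt_continuous R))).
by apply: measurable_funD; exact: measurable_funX.
Qed.

Lemma cmeasurable_det n (A : T -> 'M[R[i]]_n) :
  (forall i j, cmeasurable (fun x => A x i j)) -> cmeasurable (fun x => \det (A x)).
Proof.
move=> mA; apply: cmeasurable_sum => s; apply: cmeasurableM.
  exact: cmeasurable_cst.
by apply: cmeasurable_prod => i.
Qed.

End ComplexMeasurability.

Lemma cmeasurable_comp d d' (T : measurableType d) (T' : measurableType d')
    (R : realType) (f : T' -> R[i]) (g : T -> T') :
  cmeasurable f -> measurable_fun [set: T] g -> cmeasurable (f \o g).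
Proof.
move=> [fr fi] mg.
by split; [exact: (measurableT_comp fr)|exact: (measurableT_comp fi)].
Qed.

(** * Continuity of the real and imaginary parts *)

Section ComplexTopology.
Context (R : realType).

(** Translates between the balls of [R[i]], whose radii lie in [R[i]], and the real-valued
    modulus. *)
Lemma cmod_near (x : R[i]) (e : R) : 0 < e -> \forall y \near x, cmod (x - y) < e.
Proof.
move=> e0; have : nbhs x (ball x e%:C%C) by apply: (@nbhsx_ballx _ R[i]); rewrite ltcR.
apply: filterS => y; rewrite /ball/= normc_def ltcR.
by case: (x - y).
Qed.

Lemma normr_Re_le (x : R[i]) : `|complex.Re x| <= cmod x.
Proof. by have := normc_ge_Re x; rewrite normc_def lecR; case: x. Qed.

Lemma normr_Im_le (x : R[i]) : `|complex.Im x| <= cmod x.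
Proof.
case: x => a b /=; rewrite -sqrtr_sqr ler_sqrt ?addr_ge0 ?sqr_ge0//.
by rewrite lerDr sqr_ge0.
Qed.

Lemma continuous_Re : continuous (@complex.Re R : R[i] -> R).
Proof.
move=> x; apply/(@cvgrPdist_lt _ _ _ (nbhs x) (nbhs_filter x)) => e e0.
have := cmod_near x e0; apply: (@filterS _ (nbhs x)) => y xy.
by rewrite -raddfB; apply: le_lt_trans (normr_Re_le _) xy.
Qed.

Lemma continuous_Im : continuous (@complex.Im R : R[i] -> R).
Proof.
move=> x; apply/(@cvgrPdist_lt _ _ _ (nbhs x) (nbhs_filter x)) => e e0.
have := cmod_near x e0; apply: (@filterS _ (nbhs x)) => y xy.
by rewrite -raddfB; apply: le_lt_trans (normr_Im_le _) xy.
Qed.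

End ComplexTopology.

(** * Borel measurability on the complex space of dimension [N] *)

Section BorelC.
Context (R : realType) (N : nat).

Lemma measurable_continuous_borelC (f : 'rV[R[i]]_N -> R) :
  continuous f -> measurable_fun [set: borelC R N] (f : borelC R N -> R).
Proof.
move=> cf; apply: (measurability _ (RGenOInfty.measurableE R)).
move=> _ [_ [a ->] <-]; rewrite setTI; apply: sub_sigma_algebra.
by apply: open_comp => [x _|]; [exact: cf | exact: interval_open].
Qed.

Lemma cmeasurable_coord (k : 'I_N) :
  cmeasurable (fun z : borelC R N => (z : 'rV[R[i]]_N) ord0 k).
Proof.
split; apply: measurable_continuous_borelC => x.
- apply: (@continuous_comp _ _ _ (fun M : 'rV[R[i]]_N => M ord0 k)).
    exact: coord_continuous.
  exact: continuous_Re.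
- apply: (@continuous_comp _ _ _ (fun M : 'rV[R[i]]_N => M ord0 k)).
    exact: coord_continuous.
  exact: continuous_Im.
Qed.

Lemma measurable_compact_borelC (E : set 'rV[R[i]]_N) :
  compact E -> measurable (E : set (borelC R N)).
Proof.
move=> /(compact_closed (@norm_hausdorff _ _)) cE.
rewrite -[E]setCK; apply: measurableC; apply: sub_sigma_algebra.
exact: closed_openC.
Qed.

Lemma measurable_VDM n :
  measurable_fun [set: n.-tuple (borelC R N)] (fun z => cmod (VDM z)).
Proof.
apply: measurable_cmod; apply: cmeasurable_det => i j.
under eq_fun do rewrite mxE /monomial.
apply: cmeasurable_prod => k; apply: cmeasurableX.
exact: (cmeasurable_comp (cmeasurable_coord k) (measurable_tnth j)).
Qed.

End BorelC.

(** * Upper semicontinuous weights and boundedness on a compact set *)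

Section Weight.
Context (R : realType) (N : nat).
Variables (E : set 'rV[R[i]]_N) (w : 'rV[R[i]]_N -> R).
Hypothesis E_compact : compact E.
Hypothesis w_usc : upper_semicontinuous (fun z : subspace E => (w z)%:E).

(** Upper semicontinuity for the relative topology of [E], restated with neighbourhoods in the
    ambient space. *)
Lemma weight_near x a : E x -> w x < a -> \forall y \near x, E y -> w y < a.
Proof.
move=> Ex wxa; have [|V + VP] := w_usc (x := x : subspace E) (a := - a).
  by rewrite -EFinN lte_fin ltrN2.
rewrite {1}/nbhs/= -nbhs_subspace_in// => Vx.
suff : nbhs x (fun y => E y -> V y).
  by apply: filterS => y Vy Ey; have := VP y (Vy Ey); rewrite -EFinN lte_fin ltrN2.
exact: Vx.
Qed.

Lemma measurable_weight : measurable_fun [set: borelC R N] (w \_ E).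
Proof.
have mE := measurable_compact_borelC E_compact.
apply/(measurable_restrictT _ mE).
apply: (measurability _ (RGenInftyO.measurableE R)).
move=> _ [_ [a ->] <-].
(* Strict sublevel sets of the weight are relatively open in [E], hence Borel. *)
have -> : E `&` w @^-1` `]-oo, a[%classic =
    E `&` ([set y | E y -> w y < a] : set 'rV[R[i]]_N)°.
  apply/seteqP; split => x [Ex]; rewrite /= in_itv/= => wx; split => //.
    exact: weight_near.
  exact: (nbhs_singleton wx).
by apply: measurableI => //; apply: sub_sigma_algebra; exact: open_interior.
Qed.

(** Compactness, in the form of near-coverings, turns local upper bounds into a uniform one. *)
Lemma near_bounded (f : 'rV[R[i]]_N -> R) :
  (forall x, E x -> exists a, \forall y \near x, E y -> f y <= a) ->
  exists B, forall x, E x -> f x <= B.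
Proof.
move=> lf; have /compact_near_coveringP cE := E_compact.
have : \forall B \near +oo, E `<=` (fun x => E x -> f x <= B).
  apply: cE => x /lf[a fa].
  exists ([set y | E y -> f y <= a], [set B | a <= B]) => /=.
    by split => //; apply: nbhs_pinfty_ge; exact: num_real.
  by move=> [y B] /= [fy aB] Ey; exact: le_trans (fy Ey) aB.
(* A neighbourhood of [+oo] only controls values strictly above [B], hence [B + 1]. *)
by move=> [B [_ fB]]; exists (B + 1) => x Ex; apply: fB => //; rewrite ltrDl.
Qed.

Lemma weight_bounded : exists B, forall x, E x -> w x <= B.
Proof.
apply: near_bounded => x Ex; exists (w x + 1).
have : w x < w x + 1 by rewrite ltrDl.
by move=> /(weight_near Ex); apply: filterS => y wy /wy /ltW.
Qed.

Lemma coord_bounded k : exists B, forall x, E x -> cmod (x ord0 k) <= B.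
Proof.
apply: near_bounded => x Ex; exists (cmod (x ord0 k) + 1).
have : \forall y \near x, cmod (x ord0 k - (y : 'rV[R[i]]_N) ord0 k) < 1.

  exact: (@coord_continuous _ _ _ ord0 k x _ (cmod_near (x ord0 k) ltr01)).
apply: filterS => y xy _; rewrite -[y ord0 k](subKr (x ord0 k)).
apply: le_trans (le_normcD _ _) _.
by rewrite normcN lerD2l ltW.
Qed.

End Weight.

(** * The Bernstein-Markov inequality in squared form *)

Section BernsteinMarkov.
Context (R : realType) (N : nat).
Variables (E : set 'rV[R[i]]_N) (w : 'rV[R[i]]_N -> R).
Variable mu : {finite_measure set (borelC R N) -> \bar R}.
Hypothesis E_compact : compact E.
Hypothesis w_ge0 : forall z, E z -> 0 <= w z.
Hypothesis w_usc : upper_semicontinuous (fun z : subspace E => (w z)%:E).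

Let cbounded (f : 'rV[R[i]]_N -> R[i]) :=
  exists B, forall x, E x -> cmod (f x) <= B.

Lemma cmod_ge0 (x : R[i]) : 0 <= cmod x.
Proof. by case: x => a b; exact: sqrtr_ge0. Qed.

Let cboundedM f g : cbounded f -> cbounded g -> cbounded (fun x => f x * g x).
Proof.
move=> [A fA] [B gB]; exists (A * B) => x Ex; rewrite ComplexField.Normc.normcM.
by apply: ler_pM; rewrite ?cmod_ge0//; [exact: fA|exact: gB].
Qed.

Let cboundedX f n : cbounded f -> cbounded (fun x => f x ^+ n).
Proof.
move=> bf; elim: n => [|n IHn]; first by exists (cmod 1).
by under [X in cbounded X]eq_fun do rewrite exprS; exact: cboundedM.
Qed.

Lemma poly_bounded (p : mpoly N R[i]) :
  exists B, forall x, E x -> cmod (meval (x ord0) p) <= B.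
Proof.
under eq_exists do under eq_forall do rewrite mevalE.
elim: (msupp p) => [|m s [A sA]].
  by exists (cmod 0) => x _; rewrite big_nil.
have [B mB] : cbounded (fun x => mcoeff m p * \prod_i x ord0 i ^+ m i).
  apply: cboundedM; first by exists (cmod (mcoeff m p)).
  elim: (index_enum _) => [|k t IHt].
    by exists (cmod 1) => x _; rewrite big_nil.
  under [X in cbounded X]eq_fun do rewrite big_cons.
  apply: cboundedM => //; apply: cboundedX; exact: coord_bounded.
exists (B + A) => x Ex; rewrite big_cons; apply: le_trans (le_normcD _ _) _.
by apply: lerD; [exact: mB|exact: sA].
Qed.

(** Ensures that the [sup] in [Bernstein_Markov] dominates every value on [E]; on an unbounded set
    it would be the default 0. *)
Lemma weighted_poly_bounded n (p : mpoly N R[i]) :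
  exists B, forall x, E x -> weighted_poly w n p x <= B.
Proof.
have [A wA] := weight_bounded E_compact w_usc; have [B pB] := poly_bounded p.
exists (A ^+ n * B) => x Ex; apply: ler_pM; rewrite ?cmod_ge0 ?exprn_ge0 ?w_ge0//.
  by apply: lerXn2r; rewrite ?nnegrE ?w_ge0 ?wA// (le_trans (w_ge0 Ex))// wA.
exact: pB.
Qed.

(** Squaring replaces the norm by an integral, which can be iterated over the coordinates. *)
Lemma Bernstein_Markov_sqr (eps : R) : Bernstein_Markov E w mu -> 0 < eps ->
  exists2 K : R, 1 <= K & forall (d : nat) (p : mpoly N R[i]) (z : borelC R N),
    (0 < d)%N -> poly_deg_le d p -> E z ->
    ((weighted_poly w d p z ^+ 2)%:E <= ((K * (1 + eps) ^+ d) ^+ 2)%:E *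
      \int[mu]_x (weighted_poly (w \_ E) d p x ^+ 2)%:E)%E.
Proof.
move=> BM eps0; have [M HM] := BM eps eps0.
(* The given [M] may fail to be positive; enlarging it to at least 1 keeps the inequality. *)
exists (Num.max 1 M) => [|d p z d0 pd Ez]; first by rewrite le_max lexx.
set K := Num.max 1 M; set c := (1 + eps) ^+ d.
have K0 : 0 < K by rewrite /K lt_max ltr01.
have c0 : 0 < c by rewrite exprn_gt0// addr_gt0.
have v0 : 0 <= weighted_poly w d p z.
  by rewrite mulr_ge0 ?cmod_ge0// exprn_ge0// w_ge0.
set I := (\int[mu]_x _)%E.
have LE : ('N[mu]_2%:E [(EFin \o weighted_poly w d p) \_ E] = I `^ 2^-1)%E.
  rewrite unlock; congr (_ `^ _)%E; apply: eq_integral => x _.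
  rewrite /weighted_poly /patch; case: ifPn => xE /=.
    rewrite powR_mulrn// ger0_norm// mulr_ge0 ?cmod_ge0// exprn_ge0// w_ge0//.
    exact: set_mem.
  (* Outside [E] both integrands vanish: as [d] is positive, the [d]-th power of the zero weight is
     0. *)
  by rewrite normr0 powR0// expr0n gtn_eqF// mul0r expr0n.
have vI : ((weighted_poly w d p z)%:E <= (K * c)%:E * I `^ 2^-1)%E.
  have [B pB] := weighted_poly_bounded d p.
  apply: (@le_trans _ _ (sup [set weighted_poly w d p z | z in E])%:E).
    rewrite lee_fin; apply: ub_le_sup; last by exists z.
    by exists B => _ [x Ex <-]; exact: pB.
  apply: le_trans (HM d p pd) _; rewrite LE.
  apply: lee_wpmul2r; first exact: poweR_ge0.
  by rewrite lee_fin ler_wpM2r ?(ltW c0)// /K le_max lexx orbT.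
have I0 : (0 <= I)%E by apply: integral_ge0 => x _; rewrite lee_fin sqr_ge0.
move: I0 vI; case: I {LE} => [r| |]// r0.
- rewrite poweR_EFin -!EFinM !lee_fin => vI.
  apply: (@le_trans _ _ ((K * c * r `^ 2^-1) ^+ 2)).
    by rewrite lerXn2r ?nnegrE// (le_trans v0 vI).
  by rewrite [leLHS]exprMn powR12_sqrt// sqr_sqrtr.
- by move=> _; rewrite gt0_muley ?leey// lte_fin exprn_gt0// mulr_gt0.
Qed.

End BernsteinMarkov.

(** * Bounds for the weighted Vandermonde density *)

Section WeightedVandermonde.
Context (R : realType) (N : nat).
Variables (E : set 'rV[R[i]]_N) (w : 'rV[R[i]]_N -> R).
Variable mu : {finite_measure set (borelC R N) -> \bar R}.
Hypothesis E_compact : compact E.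
Hypothesis w_ge0 : forall z, E z -> 0 <= w z.
Hypothesis w_usc : upper_semicontinuous (fun z : subspace E => (w z)%:E).

Lemma weight_restrict_ge0 z : 0 <= (w \_ E) z.
Proof. by rewrite /patch; case: ifPn => // /set_mem /w_ge0. Qed.

Lemma weighted_VDM_sqr_ge0 d z : 0 <= weighted_VDM_sqr (w \_ E) d z.
Proof.
rewrite mulr_ge0 ?sqr_ge0// prodr_ge0// => i _.
by rewrite exprn_ge0// weight_restrict_ge0.
Qed.

Lemma weighted_VDM_sqr_restrict d z : Epow E (nmon N d) z ->
  weighted_VDM_sqr (w \_ E) d z = weighted_VDM_sqr w d z.
Proof.
move=> Ez; congr (_ * _); apply: eq_bigr => i _.
by rewrite /patch mem_set//; exact: Ez.
Qed.

(** Together with [weighted_VDM_sqr_restrict], this makes the density for [w \_ E] the extension by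
    zero of the density on [Epow E], so integrals can run over the whole product space. *)
Lemma weighted_VDM_sqr_out d z : (0 < d)%N -> ~ Epow E (nmon N d) z ->
  weighted_VDM_sqr (w \_ E) d z = 0.
Proof.
move=> d0 /existsNP[j Ezj]; rewrite /weighted_VDM_sqr (bigD1 j)//=.
by rewrite /patch memNset// expr0n muln_eq0/= gtn_eqF// mul0r mulr0.
Qed.

Lemma measurable_weighted_VDM_sqr d :
  measurable_fun [set: (nmon N d).-tuple (borelC R N)]
    (weighted_VDM_sqr (w \_ E) d).
Proof.
apply: measurable_funM; first by apply: measurable_funX; exact: measurable_VDM.
apply: measurable_prod => j _; apply: measurable_funX.
exact: (measurableT_comp (measurable_weight E_compact w_usc) (measurable_tnth j)).
Qed.

Lemma measurable_Epow n : measurable (Epow E n).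
Proof.
rewrite (_ : Epow E n = \bigcap_j ((fun z : n.-tuple (borelC R N) => tnth z j) @^-1` E)).
  apply: fin_bigcap_measurable => // j _.
  rewrite -[X in measurable X]setTI; apply: measurable_tnth => //.
  exact: measurable_compact_borelC.
by apply/seteqP; split => z Ez j; [move=> _; exact: Ez | exact: Ez].
Qed.

Lemma measurable_weighted_poly d (p : mpoly N R[i]) :
  measurable_fun [set: borelC R N] (weighted_poly (w \_ E) d p).
Proof.
apply: measurable_funM.
  apply: measurable_funX; exact: (measurable_weight E_compact w_usc).
apply: measurable_cmod; under eq_fun do rewrite mevalE.
apply: cmeasurable_sum => m; apply: cmeasurableM; first exact: cmeasurable_cst.
by apply: cmeasurable_prod => k; apply: cmeasurableX; exact: cmeasurable_coord.
Qed.

Lemma weighted_VDM_sqr_tset d (z : (nmon N d).-tuple (borelC R N)) j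
    (p : mpoly N R[i]) :
  (forall x : borelC R N, VDM (tset z j x) = meval ((x : 'rV[R[i]]_N) ord0) p) ->
  forall x, weighted_VDM_sqr (w \_ E) d (tset z j x) =
    (\prod_(k < nmon N d | k != j) (w \_ E) (tnth z k) ^+ (2 * d)) *
    weighted_poly (w \_ E) d p x ^+ 2.
Proof.
move=> zp x; rewrite /weighted_VDM_sqr zp (bigD1 j)//= tnth_tset eqxx.
rewrite /weighted_poly exprMn -exprM [(d * 2)%N]mulnC.
rewrite (eq_bigr (fun k => (w \_ E) (tnth z k) ^+ (2 * d))); first by ring.
by move=> k kj; rewrite tnth_tset (negbTE kj).
Qed.

Lemma Zd_restrict d : (0 < d)%N ->
  Zd E w mu d = (\int[mpow mu (nmon N d)]_z (weighted_VDM_sqr (w \_ E) d z)%:E)%E.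
Proof.
move=> d0; rewrite /Zd integral_mkcond; apply: eq_integral => z _.
rewrite /patch; case: ifPn => [/set_mem Ez|/negP Ez].
  by rewrite -weighted_VDM_sqr_restrict.
by rewrite weighted_VDM_sqr_out// => /mem_set.
Qed.

(** Each coordinate integrated out by [le_integral_mpow] costs one factor from
    [Bernstein_Markov_sqr]. *)
Lemma weighted_VDM_sqr_le_Zd (eps : R) : Bernstein_Markov E w mu -> 0 < eps ->
  exists2 K : R, 1 <= K & forall d z, (0 < d)%N -> Epow E (nmon N d) z ->
    ((weighted_VDM_sqr w d z)%:E <=
       (((K * (1 + eps) ^+ d) ^+ 2) ^+ nmon N d)%:E * Zd E w mu d)%E.
Proof.
move=> BM eps0.
have [K K1 HK] := Bernstein_Markov_sqr E_compact w_ge0 w_usc BM eps0.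
exists K => // d z d0 Ez; rewrite Zd_restrict// EFin_expe.
rewrite -weighted_VDM_sqr_restrict//.
apply: (le_integral_mpow (G := fun z => (weighted_VDM_sqr (w \_ E) d z)%:E)).
- by rewrite lee_fin sqr_ge0.
- apply/measurable_EFinP; exact: measurable_weighted_VDM_sqr.
- by move=> y; rewrite lee_fin weighted_VDM_sqr_ge0.
(* The one-coordinate bound is required at every tuple; if coordinate [j] lies outside [E], its left
   side is 0. *)
move=> {Ez}z j; have [Ej|Ej] := pselect (E (tnth z j)); last first.
  have zE : ~ Epow E (nmon N d) z by move=> /(_ j).
  rewrite weighted_VDM_sqr_out//.
  rewrite mule_ge0 ?lee_fin ?sqr_ge0// integral_ge0// => x _.
  by rewrite lee_fin weighted_VDM_sqr_ge0.
have [p pd zp] := VDM_tset z j.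
rewrite -{1}(tset_id z j).
(* The weights of the other coordinates form a constant factor, common to both sides. *)
under eq_integral do rewrite (weighted_VDM_sqr_tset zp) EFinM.
rewrite (weighted_VDM_sqr_tset zp) EFinM ge0_integralZl//; last 3 first.
- by apply/measurable_EFinP/measurable_funX; exact: measurable_weighted_poly.
- by move=> x _; rewrite lee_fin sqr_ge0.
- by rewrite lee_fin prodr_ge0// => k _; rewrite exprn_ge0// weight_restrict_ge0.
rewrite muleCA; apply: lee_wpmul2l.
  by rewrite lee_fin prodr_ge0// => k _; rewrite exprn_ge0// weight_restrict_ge0.
have := HK d p (tnth z j) d0 pd Ej.
by rewrite {1}/weighted_poly -[w (tnth z j)]/(w _) {2}/weighted_poly /patch mem_set.
Qed.

(** On [B] the integrand is below [a], and the mass of [B] is at most the total mass given by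
    [mpow_setT]. *)
Lemma integral_small_VDM_le d (a : R) (B : set ((nmon N d).-tuple (borelC R N))) :
  0 <= a -> B = Epow E (nmon N d) `&` [set z | weighted_VDM_sqr w d z < a] ->
  (\int[mpow mu (nmon N d)]_(z in B) (weighted_VDM_sqr w d z)%:E <=
   a%:E * mu setT ^+ nmon N d)%E.
Proof.
move=> a0 BE.
have mW := @measurable_weighted_VDM_sqr d.
have mB : measurable B.
  rewrite (_ : B = Epow E (nmon N d) `&`
      (weighted_VDM_sqr (w \_ E) d) @^-1` `]-oo, a[%classic); last first.
    rewrite BE; apply/seteqP; split => z [Ez] /=; rewrite in_itv/=;
      by rewrite weighted_VDM_sqr_restrict.
  apply: measurableI; first exact: measurable_Epow.
  by rewrite -[X in measurable X]setTI; apply: mW.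
rewrite (eq_integral (fun z => (weighted_VDM_sqr (w \_ E) d z)%:E)); last first.
  move=> z /set_mem; rewrite BE => -[Ez _].
  by rewrite weighted_VDM_sqr_restrict.
apply: (@le_trans _ _ (\int[mpow mu (nmon N d)]_(z in B) cst a%:E z)%E).
  apply: ge0_le_integral => //.
  - by move=> z _; rewrite lee_fin weighted_VDM_sqr_ge0.
  - by apply/measurable_EFinP; apply: measurable_funTS.
  - move=> z; rewrite BE => -[Ez] /= /ltW.
    by rewrite lee_fin weighted_VDM_sqr_restrict.
rewrite integral_cst// -mpow_setT; apply: lee_wpmul2l; first by rewrite lee_fin.
by apply: le_measure; rewrite ?inE.
Qed.

End WeightedVandermonde.

(** * Degree sums and the transfinite diameter *)

(** The left side equals [N.+1 * 'C(N + d, N.+1)], and [N.+1] is at most [2 * N]. *)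
Lemma nmon_le_degsum N d : (0 < N)%N -> (d * nmon N d <= 2 * degsum N d)%N.
Proof.
move=> N0; have : (N.+1 * 'C(N + d, N.+1) = d * nmon N d)%N.
  by rewrite mul_bin_left addKn /nmon -[in RHS](bin_sub (leq_addl N d)) addnK.
by move=> <-; rewrite /degsum mulnA leq_mul2r; apply/orP; right; lia.
Qed.

Lemma degsum_gt0 N d : (0 < N)%N -> (0 < d)%N -> (0 < degsum N d)%N.
Proof.
by move=> N0 d0; rewrite muln_gt0 N0 bin_gt0 -addn1 leq_add2l.
Qed.

Section TransfiniteDiameter.
Context (R : realType) (N : nat).
Variables (E : set 'rV[R[i]]_N) (w : 'rV[R[i]]_N -> R).
Hypothesis N_gt0 : (0 < N)%N.
Hypothesis w_ge0 : forall z, E z -> 0 <= w z.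

Lemma sup_set_ge0 (S : set R) : (forall x, S x -> 0 <= x) -> 0 <= sup S.
Proof.
move=> S0; have [[[x Sx] Sub]|/sup_out ->//] := pselect (has_sup S).
by apply: le_trans (S0 x Sx) _; exact: ub_le_sup.
Qed.

(** If no element exceeded [b], then [b] would bound [S]. The sign of [b] handles the empty set,
    whose [sup] is 0 by default. *)
Lemma lt_sup (S : set R) (b : R) : 0 <= b -> b < sup S -> exists2 x, S x & b < x.
Proof.
move=> b0 bS; apply: contrapT => /forall2NP Sb; move: bS; rewrite ltNge => /negP.
apply; have [S0|/set0P/negP/negPn/eqP ->] := pselect (S !=set0).
  by apply: ge_sup => // x Sx; have [//|/negP] := Sb x; rewrite -leNgt.
by rewrite sup0.
Qed.

(* A divergent sequence has the junk limit 0, so positivity of the transfinite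
   diameter already yields convergence. *)
Lemma transfinite_diameter_near b :
  0 <= b -> b < transfinite_diameter E w ->
  \forall d \near \oo, exists2 z, Epow E (nmon N d) z &
     b ^+ (2 * degsum N d) < weighted_VDM_sqr w d z.
Proof.
move=> b0 bd.
pose u d := max_weighted_VDM E w d `^ (degsum N d)%:R^-1.
have cu : u @ \oo --> transfinite_diameter E w.
  apply: contrapT => /dvgP ud.
  by move: bd; rewrite /transfinite_diameter ud ltNge b0.
near=> d.
have d0 : (0 < d)%N by near: d; exact: nbhs_infty_gt.
have l0 := degsum_gt0 N_gt0 d0.
have bu : b < u d by near: d; exact: (cvgr_gt _ cu).
have M0 : 0 <= max_weighted_VDM E w d.
  apply: sup_set_ge0 => _ [z Ez <-]; rewrite mulr_ge0 ?cmod_ge0// prodr_ge0// => j _.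
  by rewrite exprn_ge0// w_ge0//; exact: Ez.
have : b ^+ degsum N d < max_weighted_VDM E w d.
  (* The root in [u d] is undone by the power [degsum N d], which is nonzero as [N] and [d] are
     positive. *)
  rewrite -[ltRHS](powRr1 M0) -(@mulVf _ (degsum N d)%:R) ?pnatr_eq0 -?lt0n//.
  by rewrite powRrM powR_mulrn ?powR_ge0// ltrXn2r -?lt0n.
move=> /lt_sup[|_ [z Ez <-] bz]; first exact: exprn_ge0.
exists z => //; rewrite mulnC exprM /weighted_VDM_sqr.
under eq_bigr do rewrite mulnC exprM.
by rewrite prodrXl -exprMn ltrXn2r// exprn_ge0.
Unshelve. all: by end_near. Qed.

End TransfiniteDiameter.

(** * Real inequalities for the final estimate *)

(** Used to absorb the total mass of [mu] and the Bernstein-Markov constant into one further factor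
    [(1 + eps) ^+ d]. *)
Lemma near_geometric (R : realType) (e A : R) : 0 < e ->
  \forall d \near \oo, A <= (1 + e) ^+ d.
Proof.
move=> e0.
have Bernoulli d : 1 + d%:R * e <= (1 + e) ^+ d.
  elim: d => [|d IHd]; first by rewrite mul0r addr0 expr0.
  rewrite exprS; apply: (@le_trans _ _ ((1 + e) * (1 + d%:R * e))).
    by rewrite -natr1; have : 0 <= d%:R * e * e; [rewrite !mulr_ge0// ltW|lra].
  by rewrite ler_wpM2l// addr_ge0// ltW.
near=> d; apply: le_trans (Bernoulli d).
have : A / e <= d%:R by near: d; exact: nbhs_infty_ger.
by rewrite ler_pdivrMr// => /le_trans; apply; rewrite lerDr.
Unshelve. all: by end_near. Qed.

(** After [V] and [K] are absorbed, it remains to compare bases, with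
    [(1 + eps) ^+ 3 <= 1 + 7 * eps]. Divided by [delta], the claim is [(1 - 28 * eps) * (1 + 7 *
    eps) <= (1 - 7 * eps) * (1 - 14 * eps)]: the constant 28 makes the linear terms cancel, leaving
    [294 * eps ^+ 2]. *)
Lemma weight_ratio (R : realType) (delta eta V K eps : R) (d m l : nat) :
  0 < eta -> eta <= delta -> 0 <= V -> 1 <= K -> eps = eta / (28 * delta) ->
  Num.max 1 V * K ^+ 2 <= (1 + eps) ^+ d -> (d * m <= 2 * l)%N ->
  (delta - eta) ^+ (2 * l) * V ^+ m * ((K * (1 + eps) ^+ d) ^+ 2) ^+ m <=
  (delta - eta / 4) ^+ (2 * l) * (1 - eta / (2 * delta)) ^+ (2 * l).
Proof.
move=> eta0 ed V0 K1 epsE AK dml.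
have d0 : 0 < delta by exact: lt_le_trans ed.
have eps0 : 0 < eps by rewrite epsE divr_gt0// mulr_gt0.
have epsd : eps * delta = eta / 28 by rewrite epsE; field; rewrite gt_eqF.
have eps1 : eps <= 28^-1 by rewrite -(ler_pM2r d0) epsd mulrC ler_pM2l.
have K0 : 0 <= K by exact: le_trans ler01 K1.
apply: (@le_trans _ _ (((delta - eta) * (1 + eps) ^+ 3) ^+ (2 * l))).
  rewrite [leRHS]exprMn -mulrA ler_wpM2l ?exprn_ge0 ?subr_ge0//.
  set c := (1 + eps) ^+ d in AK *.
  have e1 : 0 <= 1 + eps by rewrite addr_ge0// ltW.
  have c0 : 0 <= c by rewrite exprn_ge0.
  have VKc : V * (K * c) ^+ 2 <= c ^+ 3.
    rewrite exprMn mulrA exprS ler_wpM2r ?sqr_ge0//.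
    by apply: le_trans AK; rewrite ler_wpM2r ?sqr_ge0// le_max lexx orbT.
  (* The exponent [3 * d * m] is at most [3 * (2 * l)], giving a cube in each of the [2 * l]
     factors. *)
  rewrite -exprMn; apply: (@le_trans _ _ ((c ^+ 3) ^+ m)).
    apply: lerXn2r => //; rewrite nnegrE ?exprn_ge0//.
    by rewrite mulr_ge0 ?sqr_ge0.
  rewrite /c -!exprM mulnCA; apply: ler_weXn2l; first lra.
  by rewrite leq_mul2l dml orbT.
rewrite -exprMn lerXn2r ?nnegrE//.
- by rewrite mulr_ge0 ?subr_ge0// exprn_ge0// addr_ge0// ltW.
- rewrite mulr_ge0//; first lra.
  by rewrite subr_ge0 ler_pdivrMr ?mulr_gt0// mul1r; lra.
have -> : 1 - eta / (2 * delta) = 1 - 14 * eps.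
  by rewrite epsE; field; rewrite gt_eqF.
have -> : eta = 28 * (eps * delta) by rewrite epsd; field.
have h : (1 + eps) ^+ 3 <= 1 + 7 * eps by nra.
apply: (@le_trans _ _ ((delta - 28 * (eps * delta)) * (1 + 7 * eps))).
  by rewrite ler_wpM2l//; nra.
rewrite -subr_ge0.
have -> : (delta - 28 * (eps * delta) / 4) * (1 - 14 * eps) -
  (delta - 28 * (eps * delta)) * (1 + 7 * eps) = delta * eps ^+ 2 * 294 by field.
by rewrite !mulr_ge0// ?sqr_ge0// ltW.
Qed.

Theorem proposition3p3 (R : realType) (N : nat) (N_gt0 : (0 < N)%N)
    (E : set 'rV[R[i]]_N) (w : 'rV[R[i]]_N -> R)
    (mu : {finite_measure set (borelC R N) -> \bar R})
    (E_compact : compact E) (E_nonpluripolar : ~ pluripolar E)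
    (w_admissible : admissible_weight E w)
    (mu_support : msupport mu `<=` E)
    (EwmuBM : Bernstein_Markov E w mu)
    (eta : R) (eta_gt0 : 0 < eta) (eta_le : eta <= transfinite_diameter E w) :
  exists dstar : nat, forall d : nat, (dstar < d)%N ->
    (Pd E w mu d (Epow E (nmon N d) `\` large_VDM E w d eta) <=
     ((1 - eta / (2 * transfinite_diameter E w)) ^+ (2 * degsum N d))%:E)%E.
Proof.
have [w_ge0 w_usc _] := w_admissible.
set delta := transfinite_diameter E w in eta_le *.
have delta_gt0 : 0 < delta by exact: lt_le_trans eta_le.
pose eps := eta / (28 * delta).
have eps_gt0 : 0 < eps by rewrite divr_gt0// mulr_gt0.
have [K K1 HK] := weighted_VDM_sqr_le_Zd E_compact w_ge0 w_usc EwmuBM eps_gt0.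
pose V := fine (mu setT).
have VE : mu setT = V%:E by rewrite fineK// fin_num_measure.
have V0 : 0 <= V by rewrite fine_ge0.
have bd : delta - eta / 4 < transfinite_diameter E w.
  by rewrite ltrBlDr ltrDl divr_gt0.
have b0 : 0 < delta - eta / 4 by lra.
have [D _ HD] : \forall d \near \oo,
    (exists2 z, Epow E (nmon N d) z &
       (delta - eta / 4) ^+ (2 * degsum N d) < weighted_VDM_sqr w d z) /\
    Num.max 1 V * K ^+ 2 <= (1 + eps) ^+ d.
  near=> d; split; near: d; last exact: near_geometric.
  exact: (transfinite_diameter_near N_gt0 w_ge0 (ltW b0) bd).
(* The strict inequality gives [0 < d] even for [D = 0]. *)
exists D => d Dd; have d0 : (0 < d)%N by exact: leq_ltn_trans Dd.
have [[z Ez zb] AK] := HD d (ltnW Dd).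
set l := (2 * degsum N d)%N in zb *; set m := nmon N d in z Ez zb *.
set b := (delta - eta / 4) ^+ l in zb.
have bl0 : 0 < b by rewrite exprn_gt0.
pose C := ((K * (1 + eps) ^+ d) ^+ 2) ^+ m.
have C0 : 0 < C.
  rewrite !exprn_gt0// mulr_gt0 ?(lt_le_trans ltr01 K1)//.
  by rewrite exprn_gt0// addr_gt0.
(* A single configuration with density above [b] bounds [Zd] from below; inverting then gives a
   finite bound for the normalizing factor. *)
have Z0 : ((b / C)%:E <= Zd E w mu d)%E.
  have : (b%:E <= C%:E * Zd E w mu d)%E.
    by apply: le_trans (HK d z d0 Ez); rewrite lee_fin ltW.
  have C1 : (0 <= (C^-1)%:E)%E by rewrite lee_fin invr_ge0 ltW.
  by move=> /(lee_wpmul2l C1); rewrite muleA -!EFinM mulVf ?gt_eqF// mul1e mulrC.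
have ZV : ((Zd E w mu d)^-1 <= (C / b)%:E)%E.
  have bC0 : 0 < b / C by rewrite divr_gt0.
  have -> : (C / b)%:E = (b / C)%:E^-1%E by rewrite inver gt_eqF// invf_div.
  by rewrite lee_pV2// inE ?(le_trans _ Z0)// lee_fin divr_ge0// ltW.
have num := integral_small_VDM_le mu E_compact w_ge0 w_usc.
have a0 : 0 <= (delta - eta) ^+ l by rewrite exprn_ge0// subr_ge0.
have {num} := num d _ (Epow E m `\` large_VDM E w d eta) a0.
have BE : Epow E m `\` large_VDM E w d eta =
    Epow E m `&` [set z | weighted_VDM_sqr w d z < (delta - eta) ^+ l].
  apply/seteqP; split => y [Ey] /=.
    move=> nl; split => //; rewrite ltNge; apply/negP => yl; exact: nl.
  by rewrite ltNge => /negP nl; split => // -[].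
move=> /(_ BE); rewrite VE -EFin_expe -EFinM => num.
rewrite /Pd; apply: (@le_trans _ _ ((C / b)%:E * ((delta - eta) ^+ l * V ^+ m)%:E)%E).
  apply: lee_pmul => //.
  - by rewrite inve_ge0 (le_trans _ Z0)// lee_fin divr_ge0// ltW.
  - apply: integral_ge0 => y [Ey _]; rewrite lee_fin.
    by rewrite -(weighted_VDM_sqr_restrict w Ey) weighted_VDM_sqr_ge0.
(* Clearing the denominator [b] leaves exactly the inequality of [weight_ratio]. *)
rewrite -EFinM lee_fin mulrAC ler_pdivrMr// mulrC [leRHS]mulrC.
exact: (weight_ratio eta_gt0 eta_le V0 K1 (erefl _) AK (nmon_le_degsum d N_gt0)).
Unshelve. all: by end_near. Qed.
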